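(* Every finite solvable group $G$ of rank $k$ has a (multi-)subset $A$ with $|A|\le 85k$ and $\delta(A;G)\ge\frac1{10}$.
   Context: The rank of a finitely generated group $G$ is the minimal size of a generating set of $G$. A multi-subset of $G$ is a finite unordered collection of elements of $G$, possibly with repetitions; sizes are counted with multiplicity, and $A\cap H$ is the multi-set of elements of $A$ lying in $H$. The detection probability of $A$ is $\delta(A;G)=\inf\{1-\frac{|A\cap H|}{|A|} : H\lneq G\}$, over all proper subgroups $H$ of $G$; thus $\delta(A;G)\ge\delta$ means $|A\cap H|\le(1-\delta)|A|$ for every proper subgroup $H$. *)

(* Defs.v *)
From mathcomp Require Import all_boot all_order all_algebra all_fingroup all_solvable.
From mathcomp Require Import finmap multiset.
From mathcomp Require Import boolp classical_sets reals constructive_ereal ereal.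
Set Implicit Arguments.
Unset Strict Implicit.
Unset Printing Implicit Defensive.
Import Order.TTheory GRing.Theory Num.Theory.
Local Open Scope ring_scope.

(* The infimum is taken in the extended reals, so that the trivial group, which
   has no proper subgroup, gets the value +oo. The ratio is only meaningful for
   a nonempty A: the convention x / 0 = 0 makes every term 1 when A is empty. *)
Definition detection_prob (R : realType) (gT : finGroupType)
    (A : {mset gT}%mset) (G : {group gT}) : \bar R :=
  ereal_inf [set (1 - (size [seq x <- A | x \in H])%:R / (size A)%:R)%:E
            | H in [set H : {group gT} | H \proper G]]%classic.

Lemma detection_prob_geP (R : realType) (gT : finGroupType)
    (A : {mset gT}%mset) (G : {group gT}) (d : R) : (0 < size A)%N ->
  (d%:E <= detection_prob R A G)%E <->
  (forall H : {group gT}, H \proper G ->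
     (size [seq x <- A | x \in H])%:R <= (1 - d) * (size A)%:R).
Proof.
move=> A_gt0; have A_gt0R : 0 < (size A)%:R :> R by rewrite ltr0n.
split=> [dA H pHG|dA].
  rewrite -ler_pdivrMr // lerBrDl -lerBrDr -lee_fin.
  by apply: le_trans dA _; apply: ereal_inf_lbound; exists H.
apply: le_ereal_inf_tmp => _ [H /= pHG <-].
by rewrite lee_fin lerBrDl -lerBrDr ler_pdivrMr // dA.
Qed.

(* Main.v *)
Require Import Defs.
From mathcomp Require Import all_boot all_order all_algebra all_fingroup all_solvable.
From mathcomp Require Import finmap multiset.
From mathcomp Require Import reals constructive_ereal ereal.
From mathcomp Require Import zify lra.
Local Open Scope ring_scope.

(** Lift a good family along a chief series, as in the Gilbert-Varshamov bound.
    Let N be a minimal normal subgroup of G, of order q. A proper subgroup H with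
    H N <> G is controlled by the image of the family in G / N. If H N = G, then
    H is a complement of N since N is abelian, and H is determined by its
    elements in the N-cosets of k generators of G: there are at most q ^ k such H.
    Among the q ^ (10 k) lifts to G of a family of 10 k elements of G / N, an
    exponential moment estimate shows that few put more than 9 k elements in a
    given complement, so that some lift is good for all complements at once. *)

Section LiftThroughMinimalNormal.
Set Implicit Arguments.
Unset Strict Implicit.
Local Open Scope group_scope.
Local Open Scope nat_scope.

(** Two elements of [H] in one coset of [N] differ by an element of [H :&: N]. *)
Lemma lcoset_TI_card_le1 (gT : finGroupType) (N H : {group gT}) (x : gT) :
  H :&: N = 1%g -> #|[set n in N | (x * n)%g \in H]| <= 1.
Proof.
move=> tiHN; apply/card_le1_eqP => n1 n2; rewrite !inE.
move=> /andP[Nn1 Hn1] /andP[Nn2 Hn2]; apply/eqP; rewrite eq_sym eq_mulVg1.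
have: (n1^-1 * n2)%g \in H :&: N.
  rewrite inE (groupM (groupVr Nn1) Nn2) andbT.
  have -> : (n1^-1 * n2 = (x * n1)^-1 * (x * n2))%g by rewrite invMg -mulgA mulKg.
  exact: groupM (groupVr Hn1) Hn2.
by rewrite tiHN => /set1P ->.
Qed.

(* A hit is weighted by q + 1, where q = #|N|: each of the m independent factors
   of the sum is then at most (q + 1) + (q - 1), since at most one n in N is a hit.
   A fixed weight would not beat the q ^ k complements for large q. *)
Lemma sum_exp_hits_TI (gT : finGroupType) (N H : {group gT}) (m : nat)
    (a : 'I_m -> gT) : H :&: N = 1%g ->
  \sum_(f : {ffun 'I_m -> gT} | f \in ffun_on N)
     #|N|.+1 ^ #|[set i | (a i * f i)%g \in H]| <= (2 * #|N|) ^ m.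
Proof.
move=> tiHN; pose w x := if x \in H then #|N|.+1 else 1.
rewrite (eq_bigr (fun f : {ffun 'I_m -> gT} => \prod_i w (a i * f i)%g)); last first.
  move=> f _; rewrite -big_mkcond /= prod_nat_const; congr (_ ^ _).
  by apply: eq_card => i; rewrite inE.
(* The coordinates of [f] vary independently, so the sum of products factors. *)
rewrite -(bigA_distr_big (mem N) (fun i n => w (a i * n)%g)).
rewrite -[m in leqRHS]card_ord -prod_nat_const; apply: leq_prod => i _.
have wE n : w (a i * n)%g = 1 + #|N| * ((a i * n)%g \in H).
  by rewrite /w; case: ifP; rewrite ?muln1 ?muln0.
rewrite (eq_bigr _ (fun n _ => wE n)) big_split /= sum1_card -big_distrr /=.
rewrite -big_mkcondr sum1dep_card mul2n -addnn leq_add2l.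
by rewrite -[leqRHS]muln1 leq_mul2l lcoset_TI_card_le1 ?orbT.
Qed.

(** Since [q >= 2], [2 ^ 10 <= 3 ^ 8 <= (q + 1) ^ 8], whence [2 ^ 10 * q <= (q + 1) ^ 9]. The extra
    factor [q + 1] makes the bound strict, even for [k = 0]. *)
Lemma union_bound_arith (q k : nat) : 1 < q ->
  q ^ k * (2 * q) ^ (10 * k) < q.+1 ^ (9 * k).+1 * q ^ (10 * k).
Proof.
move=> q_gt1; rewrite expnMn mulnA ltn_pmul2r ?expn_gt0 ?(ltnW q_gt1) //.
rewrite expnM -expnMn [ltnRHS]expnS [in ltnRHS]expnM.
have q_pow : 2 ^ 10 * q <= q.+1 ^ 9.
  rewrite [leqRHS]expnSr leq_mul //.
  by apply: (@leq_trans (3 ^ 8)) => //; rewrite leq_exp2r.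
have : (q * 2 ^ 10) ^ k <= (q.+1 ^ 9) ^ k.
  by rewrite mulnC; case: k => // k; rewrite leq_exp2r.
move/leq_ltn_trans; apply.
by apply: ltn_Pmull; [apply: ltnW | rewrite !expn_gt0].
Qed.

Lemma exists_lift_few_hits (gT : finGroupType) (N : {group gT}) (k : nat)
    (a : 'I_(10 * k) -> gT) (I : finType) (J : pred I) (H : I -> {group gT}) :
  1 < #|N| -> (forall c, J c -> H c :&: N = 1%g) -> #|J| <= #|N| ^ k ->
  exists2 f : {ffun 'I_(10 * k) -> gT}, forall i, f i \in N &
    forall c, J c -> #|[set i | (a i * f i)%g \in H c]| <= 9 * k.
Proof.
move=> N_gt1 tiHN cardJ.
pose hits (f : {ffun 'I_(10 * k) -> gT}) c := #|[set i | (a i * f i)%g \in H c]|.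
pose good f := [forall (c | J c), hits f c <= 9 * k].
have [[f /andP[/ffun_onP Nf /forall_inP goodf]] | no_good] :=
  altP (@existsP _ (fun f => (f \in ffun_on N) && good f)).
  by exists f.
suff : #|N|.+1 ^ (9 * k).+1 * #|N| ^ (10 * k) <= #|N| ^ k * (2 * #|N|) ^ (10 * k).
  by rewrite leqNgt union_bound_arith.
(* Double counting: without a good lift, each [f] has some [c] with more than [9 k] hits, hence
   weight at least [#|N|.+1 ^ (9 * k).+1]. *)
apply: (@leq_trans (\sum_(f : {ffun 'I_(10 * k) -> gT} | f \in ffun_on N)
                      \sum_(c | J c) #|N|.+1 ^ hits f c)).
  rewrite mulnC -[X in _ ^ X * _]card_ord -card_ffun_on -sum_nat_const.
  apply: leq_sum => f Nf.
  have: ~~ good f by apply: contra no_good => gf; apply/existsP; exists f; rewrite Nf.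
  case/forall_inPn => c Jc; rewrite -ltnNge => hits_gt.
  by rewrite (bigD1 c) //=; apply: leq_trans (leq_addr _ _); rewrite leq_exp2l // ltnW.
rewrite exchange_big /=; apply: (@leq_trans (\sum_(c | J c) (2 * #|N|) ^ (10 * k))).
  by apply: leq_sum => c Jc; apply: sum_exp_hits_TI; apply: tiHN.
by rewrite sum_nat_const leq_mul2r cardJ orbT.
Qed.

(** Each [s j] is moved into [H] within its coset of [N]. The subgroup [K] generated by the results
    satisfies [K N = G], so the modular law gives [H = K (H :&: N) = K]. *)
Lemma complement_gen (gT : finGroupType) (G N H : {group gT}) (k : nat)
    (s : 'I_k -> gT) : N <| G -> <<[set s j | j : 'I_k]>> = G ->
  (H * N)%g = G -> H :&: N = 1%g ->
  exists2 c : {ffun 'I_k -> gT}, forall j, c j \in N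
    & <<[set (s j * c j)%g | j : 'I_k]>> = H.
Proof.
move=> nNG defG defHN tiHN.
have sN j : exists n, (n \in N) && ((s j * n)%g \in H).
  have /mulsgP[h n Hh Nn ->] : s j \in (H * N)%g.
    by rewrite defHN -defG mem_gen // imset_f.
  by exists n^-1%g; rewrite groupV Nn mulgK.
pose c := [ffun j => xchoose (sN j)].
have [Nc Hc] : (forall j, c j \in N) /\ (forall j, (s j * c j)%g \in H).
  by split=> j; rewrite ffunE; have /andP[] := xchooseP (sN j).
exists c => //; set K := <<_>>.
have sKH : K \subset H by rewrite gen_subG; apply/subsetP=> _ /imsetP[j _ ->].
have sHG : H \subset G by rewrite -defHN mulG_subl.
have nNK : K \subset 'N(N).
  exact: subset_trans sKH (subset_trans sHG (normal_norm nNG)).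
have sGKN : G \subset (K * N)%g.
  rewrite -defG -norm_joinEl // gen_subG; apply/subsetP=> _ /imsetP[j _ ->].
  rewrite -(mulgK (c j) (s j)) groupM ?groupV //.
    by apply: (subsetP (joing_subl _ _)); apply/mem_gen/imsetP; exists j.
  by rewrite (subsetP (joing_subr _ _)).
apply/eqP; rewrite eqEsubset sKH /=.
have /setIidPl <- : H \subset (K * N)%g by apply: subset_trans sGKN.
by rewrite setIC -group_modl // setIC tiHN mulg1.
Qed.

(** [H :&: N] is normalized by [H] and centralized by the abelian [N], hence normalized by
    [G = H N]. By minimality it is trivial or [N], and [N] inside [H] would force [H = G]. *)
Lemma minnormal_TI_supplement (gT : finGroupType) (G N H : {group gT}) :
  minnormal N G -> N <| G -> abelian N -> H \proper G -> (H * N)%g = G ->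
  H :&: N = 1%g.
Proof.
case/mingroupP=> _ minN nNG abN pHG defHN.
apply/eqP/idPn => ntI.
have nIG : G \subset 'N(H :&: N).
  rewrite -defHN mul_subG //.
    by rewrite normsI ?normG // (subset_trans (proper_sub pHG)) ?normal_norm.
  by rewrite cents_norm // (subset_trans abN) // centS // subsetIr.
have := minN (H :&: N)%G; rewrite /= ntI nIG subsetIr => /(_ isT isT) /setIidPr sNH.
by move: pHG; rewrite -defHN mulGSid // properxx.
Qed.

(** A generating tuple replaces the rank so that [k] stays fixed in the induction: the rank of
    [G / N] may drop. *)
Lemma solvable_detecting_family (gT : finGroupType) (G : {group gT}) (k : nat)
    (s : 'I_k -> gT) : solvable G -> <<[set s j | j : 'I_k]>> = G ->
  exists2 a : 'I_(10 * k) -> gT, forall i, a i \in G &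
    forall H : {group gT}, H \proper G -> #|[set i | a i \in H]| <= 9 * k.
Proof.
have [n] := ubnP #|G|; elim: n gT G s => // n IHn gT G s; rewrite ltnS => cardG.
move=> solG defG; have [G1 | ntG] := eqVneq (G : {set gT}) 1%g.
  exists (fun=> 1%g) => // H; rewrite G1 => /proper_card.
  by rewrite cards1 ltnNge cardG_gt0.
have [N minN sNG] := minnormal_exists ntG (normG G).
have [_ ntN abelN] := minnormal_solvable minN sNG solG.
have nNG : N <| G by rewrite /normal sNG; case/mingroupP: minN => /andP[].
have abN : abelian N by have /is_abelemP[p _ /abelem_abelian] := abelN.
have N_gt1 : 1 < #|N| by rewrite cardG_gt1.
have nNs j : s j \in 'N(N).
  by rewrite (subsetP (normal_norm nNG)) // -defG mem_gen // imset_f.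
have [] := IHn _ (G / N)%G (coset N \o s).
- by rewrite (leq_trans _ cardG) // ltn_quotient.
- exact: quotient_sol.
- rewrite /= -[in RHS]defG quotient_gen; last by apply/subsetP=> _ /imsetP[j _ ->].
  congr <<_>>; rewrite /quotient morphimEsub; first by rewrite -imset_comp.
  by apply/subsetP=> _ /imsetP[j _ ->].
move=> abar Gabar few_abar.
have liftP i : exists x, (x \in G) && (coset N x == abar i).
  by have /morphimP[x _ Gx ->] := Gabar i; exists x; rewrite Gx eqxx.
pose b i := xchoose (liftP i).
have Gb i : b i \in G by have /andP[] := xchooseP (liftP i).
have cosetb i : coset N (b i) = abar i.
  by have /andP[_ /eqP] := xchooseP (liftP i).
pose Hc (c : {ffun 'I_k -> gT}) := <<[set (s j * c j)%g | j : 'I_k]>>%G.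
pose J c := (c \in ffun_on N) && (Hc c :&: N == 1%g).
have [||f Nf few_f] := @exists_lift_few_hits _ N k b _ J Hc N_gt1.
- by move=> c /andP[_ /eqP].
- rewrite -[k in leqRHS]card_ord -card_ffun_on; apply: subset_leq_card.
  by apply/subsetP=> c /andP[].
exists (fun i => (b i * f i)%g) => [i | H pHG].
  by rewrite groupM // (subsetP sNG).
have nNH : H \subset 'N(N).
  exact: subset_trans (proper_sub pHG) (normal_norm nNG).
have [defHN | neqHN] := eqVneq (H * N)%g G.
  have tiHN := minnormal_TI_supplement minN nNG abN pHG defHN.
  have [c Nc defH] := complement_gen nNG defG defHN tiHN.
  have := few_f c; rewrite /J /Hc /= defH tiHN eqxx andbT; apply.
  exact/ffun_onP.
(* Here [H / N] is proper in [G / N], and a hit of [H] by the lift is a hit of [H / N] by [abar]. *)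
apply: leq_trans (few_abar (H / N)%G _).
  apply/subset_leq_card/subsetP=> i; rewrite !inE => Hi.
  have Nb : b i \in 'N(N) by rewrite (subsetP (normal_norm nNG)).
  have <- : coset N (b i * f i)%g = abar i.
    by rewrite morphM ?(subsetP (normG N) _ (Nf i)) //= (coset_id (Nf i)) mulg1 cosetb.
  exact: mem_quotient.
rewrite properEneq quotientS ?proper_sub // andbT.
apply: contra_neq neqHN => eqHG.
by rewrite (normC nNH) -quotientK // eqHG quotientGK.
Qed.

End LiftThroughMinimalNormal.

Theorem theorem1p13 (R : realType) (gT : finGroupType) (G : {group gT}) (k : nat)
    (solG : solvable G) (rankG : 'm(G)%g = k) :
  exists A : {mset gT}%mset,
    [/\ {subset A <= G},
        (0 < k)%N -> (0 < size A)%N,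
        (size A <= 85 * k)%N
      & ((1 / 10)%:E <= detection_prob R A G)%E].
Proof.
have [B defG cardB] := grank_witness G; rewrite rankG in cardB.
pose s (j : 'I_k) : gT := enum_val (cast_ord (esym cardB) j).
have [|a Ga few_a] := @solvable_detecting_family _ G k s solG.
  rewrite -defG; congr (generated _); apply/setP=> x; apply/imsetP/idP.
    by case=> j _ ->; apply: enum_valP.
  move=> Bx; exists (cast_ord cardB (enum_rank_in Bx x)) => //.
  by rewrite /s cast_ordK enum_rankK_in.
pose sA := [seq a i | i : 'I_(10 * k)].
have permA := perm_eq_seq_mset sA.
have sizeA : size (seq_mset sA) = (10 * k)%N.
  by rewrite (perm_size permA) size_image card_ord.
exists (seq_mset sA); split.
- by move=> x; rewrite (perm_mem permA) => /imageP[i _ ->].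
- by rewrite sizeA; lia.
- by rewrite sizeA; lia.
(* For [k = 0] the multiset is empty, but [G] is trivial and the infimum over no subgroups is
   infinite. *)
have [k0 | k_gt0] := posnP k.
  have G1 : G :=: 1%g.
    by apply/eqP; rewrite -defG (cards0_eq (etrans cardB k0)) gen0.
  apply: le_ereal_inf_tmp => y [H /= pHG _]; move: (proper_card pHG).
  by rewrite G1 cards1 ltnNge cardG_gt0.
apply/detection_prob_geP => [|H pHG]; first by rewrite sizeA; lia.
rewrite sizeA size_filter (seq.permP permA) count_map.
have -> : count (preim a (mem H)) (enum 'I_(10 * k)) = #|[set i | a i \in H]|.
  by rewrite cardsE cardE [in RHS]/enum_mem size_filter -enumT.
(* The bound [9 k] is exactly [1 - 1 / 10] of the size [10 k]. *)
have : (#|[set i | a i \in H]|%:R : R) <= (9 * k)%:R by rewrite Num.Theory.ler_nat few_a.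
rewrite !GRing.natrM; lra.
Qed.
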